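(* Let $K\in\mathbb{N}$ and let $\mathcal{P}$ be a family of probability density functions on $\mathbb{R}^K$ such that every $p\in\mathcal{P}$ has finite differential entropy $h(p) := -\int p(\mathbf{x})\log p(\mathbf{x})\,\mathrm{d}\mathbf{x}\in\mathbb{R}$. Assume that $\mathcal{P}$ is convex (for all $\alpha\in[0,1]$ and $p,q\in\mathcal{P}$ we have $\alpha p+(1-\alpha)q\in\mathcal{P}$) and that $\sup_{q\in\mathcal{P}}|h(q)|=\infty$. Fix a sample size $N\in\mathbb{N}$ and an arbitrary (measurable) estimator $\hat h\colon(\mathbb{R}^K)^N\to\mathbb{R}$. Then for any pair of constants $C,\delta>0$ there exists a continuous random vector $\mathbf{x}\sim p\in\mathcal{P}$ such that, with $\mathcal{D}=(\mathbf{x}_1,\dots,\mathbf{x}_N)$ consisting of $N$ i.i.d. copies of $\mathbf{x}$, \[ \Pr\big(|h(p)-\hat h(\mathcal{D})|\le C\big)\le\delta . \]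
   Context: Differential entropy of a density $p$ on $\mathbb{R}^K$ is $h(p)=-\int p\log p\,\mathrm{d}\lambda^K$, where $\lambda^K$ is Lebesgue measure. *)

(* Defs.v *)
From HB Require Import structures.
From mathcomp Require Import all_boot all_order all_algebra.
From mathcomp Require Import all_classical all_reals all_analysis.
Set Implicit Arguments. Unset Strict Implicit. Unset Printing Implicit Defensive.
Import Order.TTheory GRing.Theory Num.Theory.
Local Open Scope classical_set_scope.
Local Open Scope ring_scope.

Fixpoint pow_mT d (T : measurableType d) (n : nat)
  : {d' : measure_display & measurableType d'} :=
  match n with
  | O => existT (fun d' => measurableType d') _ (unit : measurableType _)
  | S k => existT (fun d' => measurableType d') _
            ((T * projT2 (pow_mT T k))%type : measurableType _)
  end.

Definition powT d (T : measurableType d) (n : nat) := projT2 (pow_mT T n).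

Fixpoint pow_meas d (T : measurableType d) (R : realType)
  (mu : set T -> \bar R) (n : nat) : set (powT T n) -> \bar R :=
  match n as n0 return set (powT T n0) -> \bar R with
  | O => (@dirac _ unit tt R : set unit -> \bar R)
  | S k => (mu \x @pow_meas d T R mu k)%E
  end.
Arguments pow_meas {d T R} mu n.

Definition RK (R : realType) (K : nat) := powT (measurableTypeR R) K.
Definition lebK (R : realType) (K : nat) : set (RK R K) -> \bar R :=
  pow_meas (@lebesgue_measure R) K.
Arguments lebK R K : clear implicits.

Definition is_pdf (R : realType) (K : nat) (p : RK R K -> R) : Prop :=
  [/\ measurable_fun setT p, (forall x, 0 <= p x)
    & (\int[lebK R K]_x (p x)%:E = 1)%E].

(* the integral defining the differential entropy exists and is finite
   (ln 0 = 0 in MathComp-Analysis, so 0 log 0 = 0) *)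
Definition finite_entropy (R : realType) (K : nat) (p : RK R K -> R) : Prop :=
  (lebK R K).-integrable setT (fun x => (p x * ln (p x))%:E).

Definition diff_entropy (R : realType) (K : nat) (p : RK R K -> R) : R :=
  - fine (\int[lebK R K]_x (p x * ln (p x))%:E)%E.

Definition pdf_measure (R : realType) (K : nat) (p : RK R K -> R)
  : set (RK R K) -> \bar R :=
  fun A => (\int[lebK R K]_(x in A) (p x)%:E)%E.

Definition convex_family (R : realType) (K : nat) (P : set (RK R K -> R)) :=
  forall (a : R) p q, 0 <= a <= 1 -> P p -> P q ->
    P (fun x => a * p x + (1 - a) * q x).

(* Main.v *)
(* Fix p0 in P and a weight e with N e <= delta/2.  Under p0^N the estimator
   exceeds some level M in absolute value with probability at most delta/2.
   Mixing moves the entropy by at most the binary entropy of the weights: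
   e h(q) + (1-e) h(p0) <= h(e q + (1-e) p0) <= e h(q) + (1-e) h(p0) + H(e).
   Since h is unbounded on P, some q in P makes |h(p)| >= M + C for the mixture
   p := e q + (1-e) p0, which lies in P by convexity; an estimate within C of
   h(p) then forces |hhat| >= M.  Finally p^N differs from p0^N by at most N e
   on every event, because each of the N factors is p0 except with
   probability e. *)

Require Import Defs.
From HB Require Import structures.
From mathcomp Require Import all_boot all_order all_algebra.
From mathcomp Require Import all_classical all_reals all_analysis.
From mathcomp Require Import measurable_realfun lra.
Import Order.TTheory GRing.Theory Num.Theory.
Local Open Scope classical_set_scope.
Local Open Scope ring_scope.

(* The library's sigma-finiteness instance for [m1 \x m2] is shadowed by the
   one for products of subprobabilities, hence this alias. *)
Section sigma_finite_product.
Local Open Scope ereal_scope.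
Context d1 d2 (T1 : measurableType d1) (T2 : measurableType d2) (R : realType).
Variables (m1 : {sigma_finite_measure set T1 -> \bar R})
  (m2 : {sigma_finite_measure set T2 -> \bar R}).

Definition sf_product : set (T1 * T2)%type -> \bar R := m1 \x m2.
HB.instance Definition _ := Measure.copy sf_product (m1 \x m2).

Lemma sf_product_sigma_finite : sigma_finite setT sf_product.
Proof.
have /sigma_finiteP[F [TF ndF Foo]] := sigma_finiteT m1.
have /sigma_finiteP[G [TG ndG Goo]] := sigma_finiteT m2.
exists (fun n => F n `*` G n).
  rewrite -setXTT TF TG predeqE => -[x y]; split.
    move=> [/= [n _ Fnx] [k _ Gky]]; exists (maxn n k) => //; split.
    - by move: x Fnx; exact/subsetPset/ndF/leq_maxl.
    - by move: y Gky; exact/subsetPset/ndG/leq_maxr.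
  by move=> [n _ []/= ? ?]; split; exists n.
move=> k; have [? ?] := Foo k; have [? ?] := Goo k.
split; first exact: measurableX.
by rewrite /sf_product product_measure1E// lte_mul_pinfty// ge0_fin_numE.
Qed.

HB.instance Definition _ := Measure_isSigmaFinite.Build _ _ _ sf_product
  sf_product_sigma_finite.
End sigma_finite_product.
Arguments sf_product {d1 d2 T1 T2 R}.

Section pow_measures.
Context d (T : measurableType d) (R : realType).

Fixpoint pow_sfmeas (mu : {sigma_finite_measure set T -> \bar R}) (n : nat) :
  {sigma_finite_measure set (powT T n) -> \bar R} :=
  match n as n0 return {sigma_finite_measure set (powT T n0) -> \bar R} with
  | O => (@dirac _ unit tt R : {sigma_finite_measure set unit -> \bar R})
  | S k => sf_product mu (pow_sfmeas mu k)
  end.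

Lemma pow_meas_sfE (mu : {sigma_finite_measure set T -> \bar R}) n :
  pow_meas mu n = pow_sfmeas mu n.
Proof. by elim: n => //= n ->. Qed.

Fixpoint pow_prob (mu : probability T R) (n : nat) : probability (powT T n) R :=
  match n as n0 return probability (powT T n0) R with
  | O => (@dirac _ unit tt R : probability unit R)
  | S k => ((mu \x pow_prob mu k)%E : probability (T * powT T k)%type R)
  end.

Lemma pow_meas_probE (mu : probability T R) n : pow_meas mu n = pow_prob mu n.
Proof. by elim: n => //= n ->. Qed.

End pow_measures.
Arguments pow_sfmeas {d T R}.
Arguments pow_meas_sfE {d T R}.
Arguments pow_prob {d T R}.

Lemma normr_sandwich_ge {R : realDomainType} (x y b : R) :
  x <= y -> y <= x + b -> `|x| - `|b| <= `|y|.
Proof.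
move=> xy yxb; have := lerB_dist x y.
rewrite distrC [`|y - x|]ger0_norm ?subr_ge0//; have := ler_norm b; lra.
Qed.

Section xlnx.
Context (R : realType).
Implicit Types x y z m e : R.

Definition xlnx x := x * ln x.

Lemma mul_ln_ratio_le z m : 0 <= z -> 0 < m -> z * (ln m - ln z) <= m - z.
Proof.
rewrite le_eqVlt => /orP[/eqP <-|z0 m0]; first by rewrite mul0r subr0 => /ltW.
have : ln m - ln z <= m / z - 1.
  rewrite -ln_div ?posrE// -[X in ln X](subrK 1) addrC.
  by apply: le_ln1Dx; rewrite ltrBrDl subrr divr_gt0.
by rewrite -(ler_pM2l z0) !mulrBr mulr1 mulrCA mulfV ?gt_eqF// mulr1.
Qed.

Lemma xlnx_convex x y e : 0 <= x -> 0 <= y -> 0 < e < 1 ->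
  xlnx (e * x + (1 - e) * y) <= e * xlnx x + (1 - e) * xlnx y.
Proof.
rewrite /xlnx => x0 y0 /andP[e0 e1]; set m := e * x + (1 - e) * y.
have : 0 <= m by rewrite /m; nra.
rewrite le_eqVlt => /orP[/eqP m0|m0].
  have [-> ->] : x = 0 /\ y = 0 by rewrite /m in m0; split; nra.
  by rewrite -m0 !mul0r !mulr0 addr0.
have gx := mul_ln_ratio_le _ _ x0 m0; have gy := mul_ln_ratio_le _ _ y0 m0.
rewrite /m in gx gy *; nra.
Qed.

Lemma xlnx_mix_ge x y e : 0 <= x -> 0 <= y -> 0 < e < 1 ->
  e * xlnx x + (1 - e) * xlnx y + (e * ln e) * x + ((1 - e) * ln (1 - e)) * y
  <= xlnx (e * x + (1 - e) * y).
Proof.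
rewrite /xlnx => x0 y0 /andP[e0 e1]; have e1' : 0 < 1 - e by rewrite subr_gt0.
set m := e * x + (1 - e) * y.
have ln_le (a z : R) : 0 < a -> 0 <= z -> a * z <= m -> z * (ln a + ln z) <= z * ln m.
  move=> a0; rewrite le_eqVlt => /orP[/eqP <-|z0 azm]; first by rewrite !mul0r.
  rewrite ler_pM2l// -lnM ?posrE// ler_ln ?posrE ?mulr_gt0//.
  by rewrite (lt_le_trans _ azm) ?mulr_gt0.
have ex_le : e * x <= m by rewrite /m; nra.
have ey_le : (1 - e) * y <= m by rewrite /m; nra.
have hx := ln_le _ _ e0 x0 ex_le; have hy := ln_le _ _ e1' y0 ey_le.
rewrite /m in hx hy *; nra.
Qed.

Definition binary_entropy e := - (e * ln e) - (1 - e) * ln (1 - e).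

End xlnx.
Arguments xlnx {R}.
Arguments binary_entropy {R}.

Section density.
Context d (T : measurableType d) (R : realType).
Local Open Scope ereal_scope.

Definition is_density (L : set T -> \bar R) (f : T -> R) :=
  [/\ measurable_fun setT f, forall x, (0 <= f x)%R & \int[L]_x (f x)%:E = 1].

Definition entropy (L : set T -> \bar R) (f : T -> R) : R :=
  (- fine (\int[L]_x (xlnx (f x))%:E))%R.

Variables (L : {measure set T -> \bar R}) (f : T -> R) (f_dens : is_density L f).

(* The unused argument lets the measure and probability instances below be
   canonical. *)
Definition density_prob of is_density L f : set T -> \bar R :=
  fun A => \int[L]_(x in A) (f x)%:E.

Let mf : measurable_fun setT f. Proof. by case: f_dens. Qed.
Let f0 x : (0 <= f x)%R. Proof. by case: f_dens. Qed.

Let density_prob0 : density_prob f_dens set0 = 0.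
Proof. exact: integral_set0. Qed.

Let density_prob_ge0 A : 0 <= density_prob f_dens A.
Proof. by apply: integral_ge0 => x _; rewrite lee_fin. Qed.

Let density_prob_sigma_additive : semi_sigma_additive (density_prob f_dens).
Proof.
apply: semi_sigma_additive_nng_induced => [|x]; first exact/measurable_EFinP.
by rewrite lee_fin.
Qed.

HB.instance Definition _ := isMeasure.Build _ _ _ (density_prob f_dens)
  density_prob0 density_prob_ge0 density_prob_sigma_additive.

Let density_probT : density_prob f_dens setT = 1.
Proof. by case: f_dens. Qed.

HB.instance Definition _ :=
  Measure_isProbability.Build _ _ _ (density_prob f_dens) density_probT.

Lemma density_integrable : L.-integrable setT (EFin \o f).
Proof.
apply/integrableP; split; first exact/measurable_EFinP.
under eq_integral => x _ do rewrite /comp gee0_abs ?lee_fin//.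
by case: f_dens => _ _ ->; rewrite ltry.
Qed.

Lemma Rintegral_density : (\int[L]_x f x)%R = 1%R.
Proof. by rewrite /Rintegral; case: f_dens => _ _ ->. Qed.

End density.
Arguments is_density {d T R}.
Arguments entropy {d T R}.
Arguments density_prob {d T R L f}.
Arguments density_integrable {d T R L f}.
Arguments Rintegral_density {d T R L f}.

Section density_mixture.
Context d (T : measurableType d) (R : realType) (L : {measure set T -> \bar R}).

Lemma density_prob_mixture (p q : T -> R) (e : R) (e01 : 0 <= e <= 1)
    (p_dens : is_density L p) (q_dens : is_density L q)
    (m_dens : is_density L (fun x => e * p x + (1 - e) * q x)) A :
  measurable A -> density_prob m_dens A =
    (e%:E * density_prob p_dens A + (1 - e)%:E * density_prob q_dens A)%E.
Proof.
move=> mA; case/andP: e01 => e0 e1; have e1' : 0 <= 1 - e by rewrite subr_ge0.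
rewrite /density_prob; case: p_dens q_dens => mp p0 _ [mq q0 _].
have mpA : measurable_fun A (EFin \o p) by exact/measurable_EFinP/measurable_funTS.
have mqA : measurable_fun A (EFin \o q) by exact/measurable_EFinP/measurable_funTS.
under eq_integral do rewrite EFinD !EFinM.
rewrite ge0_integralD//; last 4 first.
- by move=> x _; rewrite -EFinM lee_fin mulr_ge0.
- exact: measurable_funeM.
- by move=> x _; rewrite -EFinM lee_fin mulr_ge0.
- exact: measurable_funeM.
by rewrite !ge0_integralZl// => x _; rewrite lee_fin.
Qed.

End density_mixture.
Arguments density_prob_mixture {d T R L p q e}.

Lemma small_mixture_weight {R : realFieldType} (n : nat) (a : R) : 0 < a ->
  exists2 e, 0 < e < 1 & n%:R * e <= a.
Proof.
move=> a0; have n1a : 0 < n.+1%:R + a by rewrite addr_gt0.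
exists (a / (n.+1%:R + a)).
  by rewrite divr_gt0//= ltr_pdivrMr// mul1r ltrDr ltr0Sn.
rewrite mulrA ler_pdivrMr// mulrC ler_pM2l// -natr1; lra.
Qed.

Section entropy_of_mixture.
Context d (T : measurableType d) (R : realType) (L : {measure set T -> \bar R}).
Variables (p q : T -> R) (e : R).
Hypotheses (e01 : 0 < e < 1) (p_dens : is_density L p) (q_dens : is_density L q).
Let m x := e * p x + (1 - e) * q x.
Hypotheses (p_int : L.-integrable setT (fun x => (xlnx (p x))%:E))
  (q_int : L.-integrable setT (fun x => (xlnx (q x))%:E))
  (m_int : L.-integrable setT (fun x => (xlnx (m x))%:E)).

Let p_ge0 x : 0 <= p x. Proof. by case: p_dens. Qed.
Let q_ge0 x : 0 <= q x. Proof. by case: q_dens. Qed.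

Let Rintegral_comb (f g : T -> R) a b :
  L.-integrable setT (EFin \o f) -> L.-integrable setT (EFin \o g) ->
  L.-integrable setT (EFin \o (fun x => a * f x + b * g x)) /\
  \int[L]_x (a * f x + b * g x) = a * \int[L]_x f x + b * \int[L]_x g x.
Proof.
move=> fi gi; have afi := integrableZl measurableT a fi.
have bgi := integrableZl measurableT b gi.
split; first exact: eq_integrable (integrableD measurableT afi bgi).
by rewrite RintegralD// ?RintegralZl//; exact: eq_integrable.
Qed.

Lemma entropy_mixture_ge :
  e * entropy L p + (1 - e) * entropy L q <= entropy L m.
Proof.
have [comb_int comb_eq] := Rintegral_comb _ _ e (1 - e) p_int q_int.
have : \int[L]_x xlnx (m x) <= \int[L]_x (e * xlnx (p x) + (1 - e) * xlnx (q x)).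
  by apply: le_Rintegral => // x _; exact: xlnx_convex.
rewrite /entropy -!/(Rintegral _ _ _) comb_eq; lra.
Qed.

Lemma entropy_mixture_le : entropy L m <=
  e * entropy L p + (1 - e) * entropy L q + binary_entropy e.
Proof.
have [comb_int comb_eq] := Rintegral_comb _ _ e (1 - e) p_int q_int.
have [lin_int lin_eq] := Rintegral_comb _ _ (e * ln e) ((1 - e) * ln (1 - e))
  (density_integrable p_dens) (density_integrable q_dens).
have : \int[L]_x ((e * xlnx (p x) + (1 - e) * xlnx (q x)) +
                  (e * ln e * p x + (1 - e) * ln (1 - e) * q x))
    <= \int[L]_x xlnx (m x).
  apply: le_Rintegral => //; first exact: eq_integrable (integrableD _ comb_int lin_int).
  by move=> x _; rewrite addrA; exact: xlnx_mix_ge.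
rewrite (RintegralD measurableT comb_int lin_int) comb_eq lin_eq.
rewrite (Rintegral_density p_dens) (Rintegral_density q_dens).
rewrite /entropy /binary_entropy -!/(Rintegral _ _ _); lra.
Qed.

End entropy_of_mixture.
Arguments entropy_mixture_ge {d T R L p q e}.
Arguments entropy_mixture_le {d T R L p q e}.

Section mixture_power.
Local Open Scope ereal_scope.
Context d (T : measurableType d) (R : realType).
Variables (mu nu lam : probability T R) (e : R).
Hypothesis e01 : (0 <= e <= 1)%R.
Hypothesis lamE : forall A, measurable A -> lam A = e%:E * nu A + (1 - e)%:E * mu A.

Lemma mixture_integral_le (g : T -> \bar R) : measurable_fun [set: T] g ->
  (forall x, 0 <= g x <= 1) -> \int[lam]_x g x <= \int[mu]_x g x + e%:E.
Proof.
move=> mg g01; have g0 x : 0 <= g x by case/andP: (g01 x).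
have int_le1 (P : probability T R) : 0 <= \int[P]_x g x <= 1.
  rewrite integral_ge0//=; apply: (@le_trans _ _ (\int[P]_x cst 1 x)).
    apply: ge0_le_integral => //.
    by move=> x _; case/andP: (g01 x).
  by rewrite integral_cst// mul1e; exact: probability_le1.
have [e0 e1] := andP e01; have e1' : (0 <= 1 - e)%R by rewrite subr_ge0.
have -> : \int[lam]_x g x =
    \int[measure_add (mscale (NngNum e0) nu) (mscale (NngNum e1') mu)]_x g x.
  apply: eq_measure_integral => A mA _; apply: eq_trans (lamE _ mA) _.
  by rewrite /= /msum 2!big_ord_recl/= big_ord0 adde0.
rewrite ge0_integral_measure_add// !ge0_integral_mscale//=.
have /andP[+ +] := int_le1 mu; have /andP[+ +] := int_le1 nu.
case: (\int[nu]_x g x) => [b| |] //; case: (\int[mu]_x g x) => [a| |] //=.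
rewrite !lee_fin => b0 b1 a0 _.
have : (e * b <= e)%R by rewrite -[leRHS]mulr1 ler_wpM2l.
have : (0 <= e * a)%R by rewrite mulr_ge0.
lra.
Qed.

Lemma pow_prob_mixture_le n (A : set (powT T n)) : measurable A ->
  pow_prob lam n A <= pow_prob mu n A + (n%:R * e)%:E.
Proof.
elim: n A => [|n IH] A mA; first by rewrite mul0r adde0.
rewrite /= /product_measure1 /=.
set g := pow_prob mu n \o xsection A.
have mg : measurable_fun [set: T] g := measurable_fun_xsection _ mA.
apply: (@le_trans _ _ (\int[lam]_x (g x + (n%:R * e)%:E))).
  apply: ge0_le_integral => //.
  - exact: measurable_fun_xsection.
  - by apply: emeasurable_funD => //; exact: measurable_cst.
  - by move=> x _; apply: IH; exact: measurable_xsection.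
have [e0 _] := andP e01.
rewrite ge0_integralD//; last by move=> x _; rewrite lee_fin mulr_ge0.
have lamT : (lam : {measure set T -> \bar R}) setT = 1 := probability_setT lam.
rewrite integral_cst// lamT mule1 -natr1 mulrDl mul1r EFinD.
rewrite (addeC (_ * e)%:E) addeA leeD2r//; apply: mixture_integral_le => // x.
by rewrite measure_ge0 probability_le1//; exact: measurable_xsection.
Qed.

End mixture_power.
Arguments pow_prob_mixture_le {d T R mu nu lam e}.

Section norm_tail.
Context d (T : measurableType d) (R : realType).

Lemma measurable_norm_ge (g : T -> R) (M : R) : measurable_fun setT g ->
  measurable [set x | M <= `|g x|].
Proof.
move=> mg; have -> : [set x | M <= `|g x|] = (Num.norm \o g) @^-1` `[M, +oo[.
  by apply/seteqP; split => x /=; rewrite in_itv /= andbT.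
by rewrite -[X in measurable X]setTI; apply: measurableT_comp.
Qed.

Lemma measurable_dist_le (g : T -> R) (h C : R) : measurable_fun setT g ->
  measurable [set x | `|h - g x| <= C].
Proof.
move=> mg; have -> : [set x | `|h - g x| <= C] = g @^-1` `[h - C, h + C].
  by apply/seteqP; split => x /=; rewrite in_itv /= ler_distlC.
by rewrite -[X in measurable X]setTI; exact: mg.
Qed.

Lemma finite_measure_norm_ge_small (P : {finite_measure set T -> \bar R})
    (g : T -> R) (eta : R) : measurable_fun setT g -> 0 < eta ->
  exists M, (P [set x | (M <= `|g x|)%R] <= eta%:E)%E.
Proof.
move=> mg eta0; pose F n := [set x | n%:R <= `|g x|].
have mF n : measurable (F n) := measurable_norm_ge _ n%:R mg.
have F_nonincr : nonincreasing_seq F.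
  by move=> m n mn; apply/subsetPset => x /=; apply: le_trans; rewrite ler_nat.
have F_cap : \bigcap_n F n = set0.
  apply/seteqP; split => x // /(_ (Num.truncn `|g x|).+1 I); rewrite /F /=.
  by move=> /(lt_le_trans (truncnS_gt _)); rewrite ltxx.
have PF0 : (P (F 0%N) < +oo)%E by rewrite ltey_eq fin_num_measure.
have := nonincreasing_cvg_mu PF0 mF _ F_nonincr.
rewrite F_cap measure0 => /(_ measurable0) PF_cvg0.
have [n PFn] : exists n, (P (F n) <= eta%:E)%E.
  apply: contrapT => /forallNP PF_gt.
  suff : (eta%:E <= 0)%E by rewrite lee_fin leNgt eta0.
  apply: (cvge_to_ge PF_cvg0); apply: nearW => n /=.
  by rewrite ltW// ltNge; apply/negP; exact: PF_gt.
by exists n%:R.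
Qed.
End norm_tail.
Arguments measurable_dist_le {d T R}.
Arguments finite_measure_norm_ge_small {d T R}.

Section unbounded_entropy_family.
Context d (T : measurableType d) (R : realType) (L : {measure set T -> \bar R}).
Variable P : set (T -> R).
Hypothesis P_dens : forall p, P p ->
  is_density L p /\ L.-integrable setT (fun x => (xlnx (p x))%:E).
Hypothesis P_convex : forall (a : R) p q, 0 <= a <= 1 -> P p -> P q ->
  P (fun x => a * p x + (1 - a) * q x).
Hypothesis P_unbounded : ereal_sup [set `|entropy L q|%:E | q in P] = +oo%E.

Lemma unbounded_entropy_gt (B : R) : exists2 q, P q & B < `|entropy L q|.
Proof.
have /ereal_sup_gt[_ [q Pq <-]] : (B%:E < ereal_sup [set `|entropy L q|%:E | q in P])%E.
  by rewrite P_unbounded ltry.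
by rewrite lte_fin; exists q.
Qed.

Lemma mixture_entropy_unbounded p0 e (B : R) : P p0 -> 0 < e < 1 ->
  exists2 q, P q & B <= `|entropy L (fun x => e * q x + (1 - e) * p0 x)|.
Proof.
move=> Pp0 e01; have [e_gt0 e_lt1] := andP e01.
have e01W : 0 <= e <= 1 by rewrite !ltW.
have [q Pq Hq] := unbounded_entropy_gt
  ((B + `|(1 - e) * entropy L p0| + `|binary_entropy e|) / e).
exists q => //.
have [[q_dens q_int] [p0_dens p0_int]] := (P_dens _ Pq, P_dens _ Pp0).
have [_ m_int] := P_dens _ (P_convex _ _ _ e01W Pq Pp0).
have lo := entropy_mixture_ge e01 q_dens p0_dens q_int p0_int m_int.
have hi := entropy_mixture_le e01 q_dens p0_dens q_int p0_int m_int.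
have := normr_sandwich_ge _ _ _ lo hi.
have := lerB_normD (e * entropy L q) ((1 - e) * entropy L p0).
rewrite normrM (gtr0_norm e_gt0); rewrite ltr_pdivrMr// in Hq; lra.
Qed.

Theorem entropy_estimator_fails (N : nat) (hhat : powT T N -> R) :
  measurable_fun setT hhat -> forall C delta : R, 0 < delta ->
  exists p, P p /\
    (pow_meas (fun A => \int[L]_(x in A) (p x)%:E) N
       [set D | (`|entropy L p - hhat D| <= C)%R] <= delta%:E)%E.
Proof.
move=> mhhat C delta delta0; have delta20 : 0 < delta / 2 by rewrite divr_gt0.
have [p0 Pp0 _] := unbounded_entropy_gt 0; have [p0_dens _] := P_dens _ Pp0.
have [e e01 Ne] := small_mixture_weight N _ delta20.
have e01W : 0 <= e <= 1 by case/andP: e01 => e_gt0 e_lt1; rewrite !ltW.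
have [M tail] := finite_measure_norm_ge_small
  (pow_prob (density_prob p0_dens) N) _ _ mhhat delta20.
have [q Pq Hp] := mixture_entropy_unbounded _ _ (M + C) Pp0 e01.
set p := fun x => e * q x + (1 - e) * p0 x in Hp.
have [[p_dens _] [q_dens _]] := (P_dens _ (P_convex _ _ _ e01W Pq Pp0), P_dens _ Pq).
exists p; split; first exact: P_convex.
set A := [set D | _ <= C].
have mA : measurable A := measurable_dist_le _ _ _ mhhat.
have A_tail : A `<=` [set D | M <= `|hhat D|].
  by move=> D; rewrite /A /= => HD; have := lerB_dist (entropy L p) (hhat D); lra.
rewrite -[fun A => _]/(density_prob p_dens) pow_meas_probE.
apply: le_trans (pow_prob_mixture_le e01W
  (density_prob_mixture e01W q_dens p0_dens p_dens) N A mA) _.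
rewrite [delta]splitr EFinD leeD// ?lee_fin//.
apply: le_trans tail; rewrite le_measure ?inE//.
exact: measurable_norm_ge.
Qed.

End unbounded_entropy_family.

Theorem proposition1 (R : realType) (K : nat) (P : set (RK R K -> R))
  (HP : forall p, P p -> is_pdf p /\ finite_entropy p)
  (Hconv : convex_family P)
  (Hsup : ereal_sup [set (`|diff_entropy q|)%:E | q in P] = +oo%E)
  (N : nat) (hhat : powT (RK R K) N -> R) (mhhat : measurable_fun setT hhat) :
  forall C delta : R, 0 < C -> 0 < delta ->
  exists p, P p /\
    (pow_meas (pdf_measure p) N [set D : powT (RK R K) N | (`|diff_entropy p - hhat D| <= C)%R]
       <= delta%:E)%E.
Proof.
move=> C delta _ delta0.
have lebKE : lebK R K = pow_sfmeas (@lebesgue_measure R) K := pow_meas_sfE _ _.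
move: HP Hsup; rewrite /is_pdf /finite_entropy /diff_entropy /pdf_measure lebKE.
by move=> HP Hsup; exact: entropy_estimator_fails HP Hconv Hsup _ _ mhhat _ _ delta0.
Qed.
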